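(* For any feasible consumption plan $\mathbf{c}^{L}$: (a) If $(\mathbb{U}_{t}(\mathbf{c}^{L};w^{t}))_{t,w^{t}}$ satisfies the SP-MA, then it satisfies the FP-MA. (b) Suppose there exists a function $(t,w^{t}) \mapsto \bar{U}_{t}(\mathbf{c}^{L};w^{t})$ that satisfies the FP-MA and $\lim_{T \rightarrow \infty} \gamma^{T+1} E\left[ M_{T+1}(W^{T+1}) \bar{U}_{T+1}(\mathbf{c}^{L};W^{T+1}) \mid w_{0}\right] = 0$ for all $M_{T+1}$ such that $M_{T+1} = m_{T+1} M_{T}$, $M_{0}=1$ and $m_{t+1} \in \mathcal{M}$. Then $(\bar{U}_{t}(\mathbf{c}^{L};w^{t}))_{t,w^{t}}$ satisfies the SP-MA.
   Context: Setting: time is discrete. $W_t=(X_t,Y_t)$, where $(Y_t)$ is a finite-state Markov chain on $\mathbb{Y}\subseteq\mathbb{R}_+$ with transition matrix $P_{Y'|Y}$, and $(X_t)$ is i.i.d. on $[\underline{x},\bar{x}]$ with a density, independent of $Y$; $E$ denotes expectation under the induced probability $P$ over histories, $E_Y$ and $E_X$ the expectations with respect to $Y$ (given the current $y$) and $X$. $\mathcal{M} = \{ g\colon \mathbb{Y}\to\mathbb{R}_+ : \sum_{y'} g(y')P_{Y'|Y}(y'|y)=1\ \forall y\}$ is the set of conditional likelihood ratios, and the conditional relative entropy is $\mathcal{E}[\lambda](y)=E_Y[\lambda(Y')\log\lambda(Y')\mid y]$. Let $\gamma\in(0,1)$ and $\theta>0$ (penalty parameter, above the breakdown value). A consumption plan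 $\mathbf{c}^{L}=(c^{L}_t)$ has $c^L_t$ measurable with respect to the history $W^t$; feasibility implies $|c^{L}_{t}(W^{t})|\le C<\infty$ a.s. (bonds lie in a bounded set and prices in $[0,\gamma]$). SP-MA (sequential problem of the minimizing agent): functions $\mathbb{U}_t$ satisfy it iff for each $(t,w^t)$ $\mathbb{U}_{t}(\mathbf{c}^{L};w^{t}) = \min_{(m_{t+j+1})_{j}} \sum_{j=0}^{\infty}\gamma^{j} E\left[ \frac{M_{t+j}(W^{t+j})}{M_{t}(w^{t})} \{ c^{L}_{t+j}(W^{t+j}) + \theta\gamma\,\mathcal{E}[m_{t+j+1}(\cdot|W^{t+j})](Y_{t+j})\} \mid w^{t}\right]$, subject to $E_{Y}[m_{t+1}(Y_{t+1}|W^{t})\mid y_{t}]=1$, where $M_{t}=\prod_{\tau=1}^{t} m_{\tau}$, $M_{0}=1$. FP-MA (functional problem of the minimizing agent): functions $U_t$ satisfy it iff $U_{t}(\mathbf{c}^{L};w^{t}) = c^{L}_{t}(w^{t}) + \gamma \min_{m_{t+1}(\cdot|w^{t})\in\mathcal{M}} \left\{ E_{Y}\left[ m_{t+1}(Y_{t+1}|w^{t})\, \mathcal{U}_{t+1}(\mathbf{c}^{L};w^{t},Y_{t+1}) \mid y_{t}\right] + \theta\,\mathcal{E}[m_{t+1}(\cdot|w^{t})](y_{t})\right\}$, where $\mathcal{U}_{t+1}(\mathbf{c}^{L};w^{t},y_{t+1}) = E_{X}[U_{t+1}(\mathbf{c}^{L};w^{t},X_{t+1},y_{t+1})]$. It is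 assumed that the minima in both problems are attained and that $\mathbb{U}_t(\mathbf{c}^L;\cdot)$ defined by the SP-MA is measurable.
   Formalization: In (b) transversality is required from every history w^t, not only given w_0 (a mean-zero bubble γ^{-t}φ(x_1) refutes the w_0 version), and Ū is measurable; membership in 𝓜 is normalized at the current y_t only, and |c_t| ≤ C holds at every history. *)

(* Defs.v *)
From HB Require Import structures.
From mathcomp Require Import all_boot all_order all_algebra.
From mathcomp Require Import all_classical all_reals all_analysis.

Set Implicit Arguments.
Unset Strict Implicit.
Unset Printing Implicit Defensive.

Import Order.TTheory GRing.Theory Num.Theory.
Local Open Scope classical_set_scope.
Local Open Scope ring_scope.

(* ------------------------------------------------------------------------
   Conventions.
   - The Markov state space  is a finite type [Y]; [P y y'] = P_{Y'|Y}(y'|y).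
   - A history  w^t = (w_0,...,w_t), w_s = (x_s,y_s), is represented by the
     pair of sequences (hx, hy) = ([:: x_t; ...; x_0], [:: y_t; ...; y_0])
     (most recent observation FIRST), so that size hx = size hy = t.+1,
     the current state y_t is the head of hy, and extending the history by
     w_{t+1} = (x,y') is consing: (x :: hx, y' :: hy).
   - A process (t,w^t) |-> g_t(w^t) is a function  nat -> seq R -> seq Y -> R.
   - A distortion process (m_{t})_t is  m : nat -> seq R -> seq Y -> Y -> R
     with  m t.+1 hx hy y' = m_{t+1}(y' | w^t).
   ------------------------------------------------------------------------ *)

Section Defs.
Variables (R : realType) (Y : finType) (P : Y -> Y -> R).

Definition stochastic : Prop :=
  (forall y y', 0 <= P y y') /\ (forall y, \sum_(y' : Y) P y y' = 1).

Definition has_density_on (xl xh : R) (muX : probability R R) : Prop :=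
  xl < xh /\
  exists f : R -> R,
    measurable_fun setT f /\ (forall x, 0 <= f x) /\
    (forall x, ~ (xl <= x <= xh) -> f x = 0) /\
    (forall A : set R, measurable A ->
       muX A = (\int[lebesgue_measure]_(x in A) (f x)%:E)%E).

Definition hist_measurable (g : nat -> seq R -> seq Y -> R) : Prop :=
  forall t (ys : (t.+1).-tuple Y),
    measurable_fun setT (fun xs : (t.+1).-tuple R => g t (tval xs) (tval ys)).

Definition cond_entropy (lam : Y -> R) (y : Y) : R :=
  \sum_(y' : Y) P y y' * (lam y' * ln (lam y')).

Definition in_M (y : Y) (lam : Y -> R) : Prop :=
  (forall y', 0 <= lam y') /\ \sum_(y' : Y) lam y' * P y y' = 1.

Definition admissible (m : nat -> seq R -> seq Y -> Y -> R) : Prop :=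
  (forall t hx y hy, in_M y (m t.+1 hx (y :: hy))) /\
  (forall y', hist_measurable (fun t hx hy => m t.+1 hx hy y')).

Variable muX : probability R R.

(* Ew m t j f (w^t) = E[ (M_{t+j}(W^{t+j}) / M_t(w^t)) f(W^{t+j}) | w^t ],
   computed by iterating the one-step conditional expectation
   (Y' ~ P(.|y_t), X' ~ muX independent). *)
Fixpoint Ew (m : nat -> seq R -> seq Y -> Y -> R) (t j : nat)
    (f : seq R -> seq Y -> \bar R) (hx : seq R) (hy : seq Y) : \bar R :=
  match j with
  | 0 => f hx hy
  | j'.+1 =>
    match hy with
    | [::] => 0%E
    | y :: _ =>
      (\sum_(y' : Y) (P y y' * m t.+1 hx hy y')%:E *
          \int[muX]_x Ew m t.+1 j' f (x :: hx) (y' :: hy))%E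
    end
  end.

Definition entropy_at (m : nat -> seq R -> seq Y -> Y -> R) (s : nat)
    (hx : seq R) (hy : seq Y) : R :=
  match hy with
  | [::] => 0
  | y :: _ => cond_entropy (m s.+1 hx hy) y
  end.

Variables (gamma theta : R) (c : nat -> seq R -> seq Y -> R).

Definition sp_objective (m : nat -> seq R -> seq Y -> Y -> R) (t : nat)
    (hx : seq R) (hy : seq Y) : \bar R :=
  (\sum_(j <oo) ((gamma ^+ j)%:E *
     Ew m t j (fun hx' hy' =>
        (c (t + j) hx' hy' + theta * gamma * entropy_at m (t + j) hx' hy')%:E)
       hx hy))%E.

Definition is_min (S : set (\bar R)) (v : \bar R) : Prop :=
  S v /\ (forall s, S s -> (v <= s)%E).

Definition SP_MA (U : nat -> seq R -> seq Y -> R) : Prop :=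
  forall t (hx : seq R) (hy : seq Y), size hx = t.+1 -> size hy = t.+1 ->
    is_min [set sp_objective m t hx hy | m in admissible] (U t hx hy)%:E.

Definition calU (U : nat -> seq R -> seq Y -> R) (t : nat)
    (hx : seq R) (hy : seq Y) (y' : Y) : \bar R :=
  (\int[muX]_x (U t.+1 (x :: hx) (y' :: hy))%:E)%E.

Definition fp_objective (U : nat -> seq R -> seq Y -> R) (t : nat)
    (hx : seq R) (y : Y) (hy : seq Y) (lam : Y -> R) : \bar R :=
  (\sum_(y' : Y) (P y y' * lam y')%:E * calU U t hx (y :: hy) y'
     + (theta * cond_entropy lam y)%:E)%E.

Definition FP_MA (U : nat -> seq R -> seq Y -> R) : Prop :=
  forall t (hx : seq R) (y : Y) (hy : seq Y), size hx = t.+1 -> size hy = t ->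
    exists v, is_min [set fp_objective U t hx y hy lam | lam in in_M y] v /\
      (U t hx (y :: hy))%:E = ((c t hx (y :: hy))%:E + gamma%:E * v)%E.

Definition transversality (U : nat -> seq R -> seq Y -> R) : Prop :=
  forall m, admissible m ->
  forall t (hx : seq R) (hy : seq Y), size hx = t.+1 -> size hy = t.+1 ->
    (fun n : nat => ((gamma ^+ n.+1)%:E *
        Ew m t n.+1 (fun hx' hy' => (U (t + n.+1)%N hx' hy')%:E) hx hy)%E)
      @ \oo --> 0%E.

End Defs.

(* Main.v *)
(** The one-step minimisation over likelihood ratios has the explicit solution
    (Gibbs variational principle): its value is the certainty equivalent
    [- theta * ln (E_Y [exp (- calU / theta)])] and its minimiser is the
    exponential tilting [exp (- calU / theta)], normalised.  No measurable
    selection is therefore needed.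

    (b) Unrolling the functional equation [n] times along any admissible
    distortion bounds [U] by the discounted cost up to date [n] plus the
    discounted tail, with equality along the tilted distortion; transversality
    kills the tail.  Since [U] is only assumed measurable, conditional
    expectations may be infinite, and the unrolling relies on the convention
    [+oo - oo = -oo], for which integration stays monotone and remains additive
    when one summand is bounded.

    (a) Value iteration from a constant subsolution increases to a bounded
    solution of the functional equation; boundedness gives transversality, so
    by (b) it solves the sequential problem, whose value is unique. *)

Require Import Defs.
From HB Require Import structures.
From mathcomp Require Import all_boot all_order all_algebra.
From mathcomp Require Import all_classical all_reals all_analysis.
From mathcomp Require Import measurable_realfun lra ring.
Import Order.TTheory GRing.Theory Num.Theory.
Import numFieldNormedType.Exports.
Local Open Scope classical_set_scope.
Local Open Scope ring_scope.

Set Implicit Arguments.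
Unset Strict Implicit.
Unset Printing Implicit Defensive.

(** * Integrals of extended-real functions under the convention [+oo - oo = -oo] *)

Section integral_complements.
Context d (T : measurableType d) (R : realType).
Variable mu : {measure set T -> \bar R}.
Implicit Types f g : T -> \bar R.
Local Open Scope ereal_scope.

(** Going from [f] to [g], the positive part grows and the negative part shrinks, and extended-real
    subtraction is monotone in this sense even at [+oo - oo]. *)
Lemma le_integral_measurable f g : measurable_fun setT f ->
  measurable_fun setT g -> (forall x, f x <= g x) ->
  \int[mu]_x f x <= \int[mu]_x g x.
Proof.
move=> mf mg fg; rewrite integralE [leRHS]integralE leeB//.
- apply: ge0_le_integral => //; [exact: measurable_funepos..|].
  by move=> x _; apply: (@funepos_le _ _ setT) => //; rewrite ?inE// => y _.
- apply: ge0_le_integral => //; [exact: measurable_funeneg..|].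
  by move=> x _; apply: (@funeneg_le _ _ setT) => //; rewrite ?inE// => y _.
Qed.

(** Scaling by a nonnegative real respects the convention for [+oo - oo]; a negative factor would
    turn [-oo] into [+oo]. *)
Lemma muleDr_ge0l (k : R) (a b : \bar R) : (0 <= k)%R ->
  k%:E * (a + b) = k%:E * a + k%:E * b.
Proof.
move=> k0; have [->|kn0] := eqVneq k 0%R; first by rewrite !mul0e adde0.
have kp : 0 < k%:E by rewrite lte_fin lt0r kn0.
have kf : k%:E \is a fin_num by [].
case: a b => [r| |] [s| |]; rewrite ?addeNy ?addNye ?gt0_muleNy ?addeNy ?addNye//.
all: by apply: muleDr.
Qed.

Lemma ge0_mule_sumr (I : Type) (s : seq I) (F : I -> \bar R) (k : R) :
  (0 <= k)%R -> k%:E * (\sum_(i <- s) F i) = \sum_(i <- s) k%:E * F i.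
Proof.
move=> k0; elim: s => [|i s IH]; first by rewrite !big_nil mule0.
by rewrite !big_cons muleDr_ge0l// IH.
Qed.

Lemma integral_ge0Zl f (k : R) : measurable_fun setT f -> (0 <= k)%R ->
  \int[mu]_x (k%:E * f x) = k%:E * \int[mu]_x f x.
Proof.
move=> mf k0; rewrite integralE ge0_funeposM// ge0_funenegM//.
have mp := measurable_funepos mf; have mn := measurable_funeneg mf.
rewrite !ge0_integralZl//.
by rewrite -muleN -muleDr_ge0l// -integralE.
Qed.

(** Lets an infinite integral of a positive part survive an integrable perturbation. *)
Lemma maxe0_leD (a b : \bar R) : maxe a 0 <= maxe (a + b) 0 + `|b|.
Proof.
case: a b => [r| |] [s| |] //=; rewrite ?addeNy ?addNye;
  rewrite ?addye ?addey ?maxye ?maxNye ?leey ?add0e//.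
rewrite -EFinD -!EFin_max -EFinD lee_fin.
have := ler_norm (- s); have := normr_ge0 s; rewrite normrN => h0 h.
have [h1 h2] : (r + s <= Num.max (r + s) 0 /\ 0 <= Num.max (r + s) 0)%R.
  by rewrite !le_max !lexx orbT.
by rewrite ge_max; apply/andP; split; lra.
Qed.

(** Negation is not additive under the convention: at [+oo] and [-oo] the two sides are [-oo] and
    [+oo]. This inequality and the next one are enough to compare negative parts. *)
Lemma leeNN_oppD (a b : \bar R) : - a - b <= - (a + b).
Proof.
case: a b => [r| |] [s| |] //=; rewrite ?addeNy ?addNye ?oppeK ?leey ?leNye//.
by change ((- r - s)%:E <= (- (r + s))%:E); rewrite opprD.
Qed.

Lemma oppD_leD (a b : \bar R) : - (a + b) + b <= - a.
Proof.
case: a b => [r| |] [s| |] //=; rewrite ?addeNy ?addNye ?leey ?leNye//.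
by change ((- (r + s) + s)%:E <= (- r)%:E); rewrite opprD addrNK.
Qed.

(* With [+oo - oo = -oo] additivity needs the integrability of one summand only. *)
Lemma integralD_integrable_r f g : measurable_fun setT f ->
  mu.-integrable setT g ->
  \int[mu]_x (f x + g x) = \int[mu]_x f x + \int[mu]_x g x.
Proof.
move=> mf ig; have mg := measurable_int _ ig.
have [fi|nfi] := pselect (mu.-integrable setT f); first exact: integralD.
have mfg := emeasurable_funD mf mg.
have intg : \int[mu]_x g x \is a fin_num by exact: integrable_fin_num.
have intag : \int[mu]_x `|g x| < +oo by case/integrableP : ig.
have mag : measurable_fun setT (fun x => `|g x|) by exact: measurableT_comp.
pose h := fun x => f x + g x.
(* Since [|g|] has a finite integral, an infinite integral of the positive part is inherited by any
   function whose positive part is smaller by at most [|g|]. *)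
have posD (a b : T -> \bar R) : measurable_fun setT a -> measurable_fun setT b ->
    (forall x, maxe (a x) 0 <= maxe (b x) 0 + `|g x|) ->
    \int[mu]_x a^\+ x = +oo -> \int[mu]_x b^\+ x = +oo.
  move=> ma mb ab aoo; apply/eqP; rewrite eq_le leey/=.
  suff : +oo <= \int[mu]_x b^\+ x + \int[mu]_x `|g x|.
    rewrite leye_eq; move/eqP.
    by case: (\int[mu]_x b^\+ x) (\int[mu]_x `|g x|) intag => [?| |] [?| |].
  rewrite -aoo -ge0_integralD//; last exact: measurable_funepos.
  apply: ge0_le_integral => //; first exact: measurable_funepos.
    by apply: emeasurable_funD => //; exact: measurable_funepos.
  by move=> x _; rewrite !funeposE ab.
have negE (a : T -> \bar R) : a^\- = (fun x => - a x)^\+.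
  by apply/funext => x; rewrite funenegE funeposE.
have mN (a : T -> \bar R) : measurable_fun setT a ->
    measurable_fun setT (fun x => - a x) by move=> ma; exact: measurableT_comp.
have abseN' x : `|- g x| = `|g x| by rewrite abseN.
(* If the negative part of [f] has infinite integral, so has that of [f + g], and both sides are
   [-oo] because [-oo] absorbs. *)
have [f_oo|f_fin] := eqVneq (\int[mu]_x f^\- x) +oo.
  have h_oo : \int[mu]_x h^\- x = +oo.
    rewrite negE; move: f_oo; rewrite negE; apply: posD; [exact: mN..|].
    move=> x; apply: (le_trans (maxe0_leD _ (- g x))); rewrite abseN' leeD2r//.
    by rewrite ge_max !le_max leeNN_oppD lexx orbT.
  rewrite integralE -/h h_oo [X in _ = X + _]integralE f_oo.
  by rewrite !addeNy.
(* Otherwise the failure of integrability comes from the positive part, and both sides are [+oo]. *)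
have fp_oo : \int[mu]_x f^\+ x = +oo.
  apply/eqP/negPn/negP => fp; apply: nfi; apply/integrableP; split => //.
  rewrite (_ : (fun x => `|f x|) = f^\+ \+ f^\-); last by rewrite -fune_abse.
  rewrite ge0_integralD//; [|exact: measurable_funepos|exact: measurable_funeneg].
  by rewrite lte_add_pinfty// ltey.
have hp_oo : \int[mu]_x h^\+ x = +oo.
  apply: posD fp_oo => // x; exact: maxe0_leD.
have hn_fin : \int[mu]_x h^\- x != +oo.
  apply: contra f_fin => /eqP h_oo; apply/eqP; move: h_oo; rewrite !negE.
  apply: posD; [exact: mN..|].
  move=> x; rewrite -abseN'; apply: (le_trans (maxe0_leD _ (g x))).
  rewrite abseN' leeD2r//.
  by rewrite ge_max !le_max oppD_leD lexx orbT.
rewrite integralE -/h hp_oo [X in _ = X + _]integralE fp_oo.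
have neqNy (a : \bar R) : a != +oo -> - a != -oo by case: a.
rewrite !addye ?neqNy//.
by move: intg; rewrite fin_numE => /andP[].
Qed.

End integral_complements.

(** * Gibbs variational principle on a finite state space *)

Section gibbs.
Context (R : realType) (Y : finType) (P : Y -> Y -> R) (theta : R).
Hypotheses (Pstoch : stochastic P) (theta_gt0 : 0 < theta).
Implicit Types (y z : Y) (lam : Y -> R) (a : Y -> \bar R).

Let P_ge0 y z : 0 <= P y z. Proof. by case: Pstoch. Qed.
Let P_sum1 y : \sum_(z : Y) P y z = 1. Proof. by case: Pstoch. Qed.

Let P_gt0 y z (u : R) : 0 < P y z * u -> 0 < P y z.
Proof.
move=> Pu; rewrite lt0r P_ge0 andbT; apply: contraTneq Pu => ->.
by rewrite mul0r ltxx.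
Qed.

(** Convexity: the left side is the tangent at [v] of the map [u * ln u]. It reduces to
    [ln (1 + x) <= x] at [x = v / u - 1]. *)
Lemma mul_ln_ge_tangent (u v : R) : 0 <= u -> 0 < v -> u * ln v + u - v <= u * ln u.
Proof.
rewrite le_eqVlt => /predU1P[<-|u0 v0]; first by move=> v0; rewrite !mul0r; lra.
have := @le_ln1Dx R (v / u - 1); rewrite addrCA subrr addr0 ltrBrDl subrr.
rewrite divr_gt0// => /(_ isT); rewrite ln_div ?posrE// => h.
have := ler_wpM2l (ltW u0) h.
by rewrite !mulrBr mulrCA divff ?gt_eqF// !mulr1; lra.
Qed.

(** The factor [exp (- b / theta)], extended by its limit [0] at [+oo]. At [-oo] it takes the junk
    value [1], since [fine] gives [0]; the lemmas on minima exclude [-oo] wherever [P] is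
    positive. *)
Definition gibbs_weight (b : \bar R) : R :=
  if b == +oo%E then 0 else expR (- (fine b / theta)).

Definition partition_function y a : R := \sum_z P y z * gibbs_weight (a z).

Definition certainty_equivalent y a : R := - theta * ln (partition_function y a).

(* The default value [1] keeps the distortion admissible at histories where the partition function vanishes. *)
Definition gibbs y a z : R :=
  if 0 < partition_function y a
  then gibbs_weight (a z) * expR (- ln (partition_function y a)) else 1.

(** This is [fp_objective] with [calU] replaced by an arbitrary [a]; the two agree by conversion, so
    the lemmas below apply directly to the functional equation. *)
Definition distorted_cost y a lam : \bar R :=
  (\sum_(z : Y) (P y z * lam z)%:E * a z + (theta * cond_entropy P lam y)%:E)%E.

Lemma gibbs_weight_ge0 b : 0 <= gibbs_weight b.
Proof. by rewrite /gibbs_weight; case: ifP => // _; exact: expR_ge0. Qed.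

Lemma gibbs_weight_gt0 b : b != +oo%E -> 0 < gibbs_weight b.
Proof. by rewrite /gibbs_weight => /negbTE ->; exact: expR_gt0. Qed.

Lemma ln_gibbs_weight b : b != +oo%E -> ln (gibbs_weight b) = - (fine b / theta).
Proof. by rewrite /gibbs_weight => /negbTE ->; rewrite expRK. Qed.

Lemma partition_function_gt0 y a z : 0 < P y z -> a z != +oo%E ->
  0 < partition_function y a.
Proof.
move=> Pz az; rewrite /partition_function (bigD1 z)//=.
rewrite ltr_pwDl ?mulr_gt0 ?gibbs_weight_gt0//.
by apply: sumr_ge0 => i _; rewrite mulr_ge0 ?gibbs_weight_ge0.
Qed.

Lemma in_M_cst1 y : in_M P y (fun=> 1).
Proof.
by split => //; rewrite -[RHS](P_sum1 y); apply: eq_bigr => z _; rewrite mul1r.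
Qed.

Lemma gibbs_in_M y a : in_M P y (gibbs y a).
Proof.
rewrite /gibbs; case Z0 : (0 < partition_function y a); last exact: in_M_cst1.
split=> [z|]; first by rewrite mulr_ge0 ?gibbs_weight_ge0 ?expR_ge0.
under eq_bigr do rewrite mulrC mulrA; rewrite -mulr_suml.
rewrite -/(partition_function y a).
by rewrite expRN lnK// divff// gt_eqF.
Qed.

Lemma in_M_exists y lam : in_M P y lam -> exists z, 0 < P y z * lam z.
Proof.
move=> [l0 l1]; apply/not_existsP => h; move: l1; rewrite big1.
  by move/eqP; rewrite eq_sym oner_eq0.
move=> z _; apply/eqP; rewrite eq_le; apply/andP; split.
  by rewrite mulrC leNgt; apply/negP/h.
by rewrite mulr_ge0.
Qed.

(** Finite values are demanded only where the distorted law has mass; elsewhere [0 * a z = 0] even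
    for infinite [a z]. *)
Lemma distorted_cost_finite y a lam : in_M P y lam ->
  (forall z, 0 < P y z * lam z -> a z \is a fin_num) ->
  distorted_cost y a lam = (\sum_(z : Y)
    P y z * (lam z * fine (a z) + theta * (lam z * ln (lam z))))%:E.
Proof.
move=> [l0 l1] afin.
rewrite /distorted_cost (eq_bigr (fun z => (P y z * lam z * fine (a z))%:E)); last first.
  move=> z _; have := mulr_ge0 (P_ge0 y z) (l0 z).
  rewrite le_eqVlt => /predU1P[<-|Plz]; first by rewrite mul0e mul0r.
  by rewrite [RHS]EFinM fineK// afin.
rewrite sumEFin -EFinD /cond_entropy mulr_sumr -big_split/=; congr EFin.
by apply: eq_bigr => z _; ring.
Qed.

Lemma distorted_cost_eqy y a lam : in_M P y lam ->
  (forall z, 0 < P y z -> a z != -oo%E) ->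
  (exists z, 0 < P y z * lam z /\ a z = +oo%E) -> distorted_cost y a lam = +oo%E.
Proof.
move=> [l0 _] aNoo [w [Pw aw]].
rewrite /distorted_cost (_ : \sum_z _ = +oo)%E ?addye//.
apply/esum_eqyP => [z _|]; last first.
  by exists w; split; rewrite ?mem_index_enum// aw gt0_muley ?lte_fin.
have := mulr_ge0 (P_ge0 y z) (l0 z); rewrite le_eqVlt => /predU1P[<-|Plz].
  by rewrite mul0e.
have := aNoo _ (P_gt0 Plz).
by case: (a z) => // _; rewrite gt0_muley ?lte_fin.
Qed.

(** The tangent inequality is taken at [v], the normalised Gibbs density, and averaged under [P]. If
    the distorted law charges a state of value [+oo], the cost is [+oo] and the bound is trivial. *)
Lemma certainty_equivalent_le y a lam : in_M P y lam ->
  (forall z, 0 < P y z -> a z != -oo%E) -> 0 < partition_function y a ->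
  ((certainty_equivalent y a)%:E <= distorted_cost y a lam)%E.
Proof.
move=> lM aNoo Z0; have [l0 l1] := lM.
have [oo|noo] := pselect (exists z, 0 < P y z * lam z /\ a z = +oo%E).
  by rewrite (distorted_cost_eqy lM aNoo oo) leey.
have afin z : 0 < P y z * lam z -> a z \is a fin_num.
  move=> Pz; rewrite fin_numE; apply/andP; split.
    exact/aNoo/P_gt0/Pz.
  by apply/eqP => az; apply: noo; exists z.
rewrite distorted_cost_finite// lee_fin.
set L := ln (partition_function y a).
(* Both densities have mean one, so the term [theta * (lam z - ...)] averages to zero; including it
   allows a comparison state by state. *)
have -> : certainty_equivalent y a = \sum_z P y z * (- theta * L * lam z
    + theta * (lam z - gibbs_weight (a z) * expR (- L))).
  rewrite (eq_bigr (fun z => (theta - theta * L) * (lam z * P y z) -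
      theta * expR (- L) * (P y z * gibbs_weight (a z)))); last by move=> z _; ring.
  rewrite sumrB -!mulr_sumr l1 -/(partition_function y a) /certainty_equivalent.
  rewrite -mulrA expRN lnK ?posrE// mulVf ?gt_eqF// -/L; ring.
apply: ler_sum => z _.
have [P0|P0] := eqVneq (P y z) 0; first by rewrite P0 !mul0r.
apply: ler_wpM2l => //.
(* Here [lam z] must vanish, and so does the Gibbs weight: both sides are [0]. *)
have [az|az] := eqVneq (a z) +oo%E.
  have -> : lam z = 0.
    apply/eqP; rewrite eq_le l0 andbT leNgt; apply/negP => lz.
    by apply: noo; exists z; split; rewrite // mulr_gt0// lt0r P0 P_ge0.
  by rewrite /gibbs_weight az eqxx !mul0r !mulr0 subrr mulr0 addr0.
have g0 : 0 < gibbs_weight (a z) * expR (- L).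
  by rewrite mulr_gt0 ?gibbs_weight_gt0 ?expR_gt0.
have := mul_ln_ge_tangent (l0 z) g0.
rewrite lnM ?posrE ?gibbs_weight_gt0 ?expR_gt0// ln_gibbs_weight// expRK => h.
have := ler_wpM2l (ltW theta_gt0) h.
rewrite !(mulrDr, mulrBr) !mulrN (mulrCA theta (lam z)) (mulrCA theta (fine _)).
by rewrite divff ?gt_eqF// mulr1; lra.
Qed.

(** At the tilted density, [a z + theta * ln (gibbs y a z)] is the constant
    [- theta * ln (partition_function y a)] on states with finite [a z], and states of value [+oo]
    get no mass. *)
Lemma distorted_cost_gibbs y a :
  (forall z, 0 < P y z -> a z != -oo%E) -> 0 < partition_function y a ->
  distorted_cost y a (gibbs y a) = (certainty_equivalent y a)%:E.
Proof.
move=> aNoo Z0; have gM := gibbs_in_M y a.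
rewrite distorted_cost_finite//; last first.
  move=> z; rewrite fin_numE => Pg; apply/andP; split.
    exact/aNoo/P_gt0/Pg.
  apply/eqP => az; move: Pg.
  by rewrite /gibbs Z0 /gibbs_weight az eqxx mul0r mulr0 ltxx.
congr EFin; rewrite /certainty_equivalent.
transitivity (- theta * ln (partition_function y a) * \sum_z gibbs y a z * P y z); last first.
  by case: gM => _ ->; rewrite mulr1.
rewrite mulr_sumr; apply: eq_bigr => z _.
rewrite /gibbs Z0.
have [az|az] := eqVneq (a z) +oo%E.
  by rewrite /gibbs_weight az eqxx !mul0r !mulr0 addr0 mulr0.
rewrite lnM ?posrE ?gibbs_weight_gt0 ?expR_gt0// ln_gibbs_weight// expRK.
by field; rewrite gt_eqF.
Qed.

Lemma is_min_certainty_equivalent y a :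
  (forall z, 0 < P y z -> a z != -oo%E) -> 0 < partition_function y a ->
  is_min [set distorted_cost y a lam | lam in in_M P y]
    (certainty_equivalent y a)%:E.
Proof.
move=> aNoo Z0; split.
  by exists (gibbs y a); [exact: gibbs_in_M|exact: distorted_cost_gibbs].
by move=> _ [lam lM <-]; exact: certainty_equivalent_le.
Qed.

(** Converse of the previous lemma: finiteness of the minimum alone rules out the degenerate values
    of [a]. *)
Lemma finite_min_certainty_equivalent y a (v : \bar R) : v \is a fin_num ->
  is_min [set distorted_cost y a lam | lam in in_M P y] v ->
  [/\ forall z, 0 < P y z -> a z != -oo%E, 0 < partition_function y a &
     v = (certainty_equivalent y a)%:E].
Proof.
move=> vfin [[lam lM dv] vmin].
have aNoo z : 0 < P y z -> a z != -oo%E.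
  move=> Pz; apply/negP => /eqP az.
  (* The undistorted law charges every state that [P] charges, so a single value [-oo] would force
     the minimum to [-oo]. *)
  have := vmin _ (ex_intro2 _ _ _ (in_M_cst1 y) erefl).
  rewrite /distorted_cost (_ : \sum_z _ = -oo)%E; last first.
    apply/esum_eqNyP; exists z; split; rewrite ?mem_index_enum//.
    by rewrite az mulr1 gt0_muleNy ?lte_fin.
  by rewrite addNye leeNy_eq => /eqP voo; rewrite voo in vfin.
(* At a state charged by the minimiser, [a] is not [+oo], since the cost is finite; this state makes
   the partition function positive. *)
have [w Pw] := in_M_exists lM.
have Z0 : 0 < partition_function y a.
  apply: (partition_function_gt0 (P_gt0 Pw)); apply/eqP => aw.
  by move: vfin; rewrite -dv (distorted_cost_eqy lM aNoo)//; exists w.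
split => //; apply/eqP; rewrite eq_le; apply/andP; split.
  rewrite -(distorted_cost_gibbs aNoo Z0).
  by apply: vmin; exists (gibbs y a) => //; exact: gibbs_in_M.
by rewrite -dv; exact: certainty_equivalent_le.
Qed.

Lemma le_gibbs_weight (b b' : \bar R) : b \is a fin_num -> b' \is a fin_num ->
  (b <= b')%E -> gibbs_weight b' <= gibbs_weight b.
Proof.
case: b => // r _; case: b' => // s _; rewrite lee_fin => rs.
by rewrite /gibbs_weight/= ler_expR lerN2 ler_wpM2r// invr_ge0 ltW.
Qed.

Lemma partition_function_fin_gt0 y a : (forall z, a z \is a fin_num) ->
  0 < partition_function y a.
Proof.
move=> afin; have [z Pz] := in_M_exists (in_M_cst1 y).
apply: (partition_function_gt0 (P_gt0 Pz)).
by have := afin z; rewrite fin_numE => /andP[].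
Qed.

Lemma le_certainty_equivalent y a b : (forall z, a z \is a fin_num) ->
  (forall z, b z \is a fin_num) -> (forall z, (a z <= b z)%E) ->
  certainty_equivalent y a <= certainty_equivalent y b.
Proof.
move=> afin bfin ab; rewrite /certainty_equivalent !mulNr lerN2 ler_pM2l//.
rewrite ler_ln ?posrE ?partition_function_fin_gt0//.
by apply: ler_sum => z _; rewrite ler_wpM2l// le_gibbs_weight.
Qed.

Lemma certainty_equivalent_cst y (K : R) :
  certainty_equivalent y (fun=> K%:E) = K.
Proof.
rewrite /certainty_equivalent /partition_function -mulr_suml.
case: Pstoch => _ ->; rewrite mul1r ln_gibbs_weight//=.
by field; rewrite gt_eqF.
Qed.

(** Monotonicity and invariance of constants suffice: [a] is compared with the constants [- K] and
    [K]. *)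
Lemma certainty_equivalent_bound y a (K : R) : (forall z, `|a z| <= K%:E)%E ->
  `|certainty_equivalent y a| <= K.
Proof.
move=> aK; have afin z : a z \is a fin_num.
  by rewrite -abse_fin_num fin_numElt (lt_le_trans _ (abse_ge0 _))// (le_lt_trans (aK z)) ?ltry.
have aK' z : ((- K)%:E <= a z <= K%:E)%E.
  by rewrite -(fineK (afin z)) !lee_fin -ler_norml -lee_fin -abse_EFin fineK.
rewrite ler_norml -{1}(certainty_equivalent_cst y (- K)).
rewrite -{2}(certainty_equivalent_cst y K).
by apply/andP; split; apply: le_certainty_equivalent => // z; have /andP[] := aK' z.
Qed.

Lemma cvg_certainty_equivalent y (a_ : nat -> Y -> \bar R) a :
  (forall n z, a_ n z \is a fin_num) -> (forall z, a z \is a fin_num) ->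
  (forall z, a_ n z @[n --> \oo] --> a z) ->
  certainty_equivalent y (a_ n) @[n --> \oo] --> certainty_equivalent y a.
Proof.
move=> anfin afin ana; apply: cvgMr.
apply: (@continuous_cvg _ _ _ _ _ _ (@ln R)).
  exact/continuous_ln/partition_function_fin_gt0.
apply: cvg_big => [|z _]; first exact: add_continuous.
apply: cvgMr.
have -> : (fun n => gibbs_weight (a_ n z)) = (fun n => expR (- (fine (a_ n z) / theta))).
  apply/funext => n; rewrite /gibbs_weight ifF//; apply/negbTE.
  by have := anfin n z; rewrite fin_numE => /andP[].
rewrite /gibbs_weight ifF; last first.
  by apply/negbTE; have := afin z; rewrite fin_numE => /andP[].
apply: (@continuous_cvg _ _ _ _ _ _ expR); first exact: continuous_expR.
apply: cvgN; apply: cvgMl; apply: fine_cvg.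
by rewrite fineK.
Qed.

Lemma measurable_gibbs_weight : measurable_fun setT gibbs_weight.
Proof.
apply: measurable_fun_ifT => //.
  apply: (measurable_fun_bool true); rewrite setTI.
  rewrite (_ : _ @^-1` _ = [set +oo%E]); first exact: emeasurable_set1.
  by apply/seteqP; split => x /= /eqP.
apply: measurableT_comp; first exact: measurable_expR.
apply: measurable_funN.
by apply: measurable_funM; [exact: fine_measurable|exact: measurable_cst].
Qed.

Lemma measurable_partition_function y d (T : measurableType d)
    (F : T -> Y -> \bar R) : (forall z, measurable_fun setT (F ^~ z)) ->
  measurable_fun setT (fun t => partition_function y (F t)).
Proof.
move=> mF; apply: measurable_sum => z; apply: measurable_funM => //.
exact: measurableT_comp measurable_gibbs_weight (mF z).
Qed.

Lemma measurable_gibbs y z d (T : measurableType d) (F : T -> Y -> \bar R) :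
  (forall z, measurable_fun setT (F ^~ z)) ->
  (forall t, 0 < partition_function y (F t)) ->
  measurable_fun setT (fun t => gibbs y (F t) z).
Proof.
move=> mF Z0; rewrite (_ : (fun t => _) = (fun t => gibbs_weight (F t z) *
    expR (- ln (partition_function y (F t))))); last first.
  by apply/funext => t; rewrite /gibbs Z0.
apply: measurable_funM; first exact: measurableT_comp measurable_gibbs_weight (mF z).
apply: measurableT_comp; first exact: measurable_expR.
apply: measurable_funN; apply: measurableT_comp; first exact: measurable_ln.
exact: measurable_partition_function.
Qed.

End gibbs.

(** * Distorted conditional expectations: measurability, monotonicity, linearity, bounds *)

Section conditional_expectations.
Context (R : realType) (Y : finType) (P : Y -> Y -> R) (muX : probability R R).
Hypothesis Pstoch : stochastic P.
Local Notation distortion := (nat -> seq R -> seq Y -> Y -> R).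
Implicit Types (m : distortion) (f g : seq R -> seq Y -> \bar R).

Let P_ge0 y z : 0 <= P y z. Proof. by case: Pstoch. Qed.

Definition hist_size (t : nat) (hx : seq R) (hy : seq Y) : Prop :=
  size hx = t.+1 /\ size hy = t.+1.

Definition emeas_at (t : nat) f : Prop := forall ys : t.+1.-tuple Y,
  measurable_fun setT (fun xs : t.+1.-tuple R => f (tval xs) (tval ys)).

Definition ebound_at (t : nat) (K : R) f : Prop :=
  forall hx hy, hist_size t hx hy -> (`|f hx hy| <= K%:E)%E.

Lemma hist_size_cons t hx hy x y :
  hist_size t hx hy -> hist_size t.+1 (x :: hx) (y :: hy).
Proof. by move=> [shx shy]; split; rewrite /= ?shx ?shy. Qed.

Lemma hist_measurable_emeas (c : nat -> seq R -> seq Y -> R) t :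
  hist_measurable c -> emeas_at t (fun hx hy => (c t hx hy)%:E).
Proof. by move=> mc ys; apply/measurable_EFinP; exact: mc. Qed.

Lemma emeas_slice t f hx hy z : emeas_at t.+1 f -> hist_size t hx hy ->
  measurable_fun setT (fun x => f (x :: hx) (z :: hy)).
Proof.
move=> mf [shx shy].
have sx : size hx == t.+1 by apply/eqP.
have sy : size (z :: hy) == t.+2 by rewrite /= shy.
have mcons : measurable_fun setT
    (fun x : R => [the t.+2.-tuple R of x :: Tuple sx]).
  exact: measurable_cons.
exact: (measurableT_comp (mf (Tuple sy)) mcons).
Qed.

Lemma emeas_integral t f z : emeas_at t.+1 f ->
  emeas_at t (fun hx hy => \int[muX]_x f (x :: hx) (z :: hy))%E.
Proof.
move=> mf ys /=.
pose G (p : t.+1.-tuple R * R) := f (p.2 :: tval p.1) (z :: tval ys).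
have mG : measurable_fun setT G.
  have mcons : measurable_fun setT
      (fun p : t.+1.-tuple R * R => [the t.+2.-tuple R of p.2 :: p.1]).
    exact: measurable_cons.
  exact: (measurableT_comp (mf [tuple of z :: ys]) mcons).
(* The slices of [f] may fail to be integrable, so Tonelli's theorem is applied to the positive and
   negative parts separately. *)
rewrite (_ : (fun xs => _) =
    (fun xs => fubini_F muX G^\+%E xs - fubini_F muX G^\-%E xs)%E); last first.
  apply/funext => xs; rewrite integralE /fubini_F.
  by congr (_ - _)%E; apply: eq_integral => x _; rewrite ?funeposE ?funenegE.
apply: emeasurable_funB.
- apply: measurable_fun_fubini_tonelli_F; last exact: funepos_ge0.
  exact: measurable_funepos.
- apply: measurable_fun_fubini_tonelli_F; last exact: funeneg_ge0.
  exact: measurable_funeneg.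
Qed.

(** One level of the recursion in [Ew], isolated as an operator so that inductions on the horizon
    can peel off the first period. *)
Definition step m t f (hx : seq R) (hy : seq Y) : \bar R :=
  match hy with
  | [::] => 0%E
  | y :: _ => (\sum_(z : Y) (P y z * m t.+1 hx hy z)%:E *
                  \int[muX]_x f (x :: hx) (z :: hy))%E
  end.

Lemma EwS m t j f : Ew P muX m t j.+1 f = step m t (Ew P muX m t.+1 j f).
Proof. by []. Qed.

Lemma emeas_step m t f : admissible P m -> emeas_at t.+1 f ->
  emeas_at t (step m t f).
Proof.
move=> [_ mm] mf ys; rewrite /step.
have := mf; case E : (tval ys) => [|y hy]; first by move=> _; exact: measurable_cst.
move=> _; apply: emeasurable_sum => z; apply: emeasurable_funM.
  apply/measurable_EFinP; apply: measurable_funM; first exact: measurable_cst.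
  by have := mm z t ys; rewrite E.
by have := emeas_integral z mf ys; rewrite E.
Qed.

Lemma emeas_Ew m t j f : admissible P m -> emeas_at (t + j) f ->
  emeas_at t (Ew P muX m t j f).
Proof.
move=> am; elim: j t => [|j IH] t; first by rewrite addn0.
by rewrite -addSnnS => mf; rewrite EwS; apply: emeas_step => //; exact: IH.
Qed.

Lemma ebounded_integrable t K f hx hy z : emeas_at t.+1 f -> ebound_at t.+1 K f ->
  hist_size t hx hy -> muX.-integrable setT (fun x => f (x :: hx) (z :: hy)).
Proof.
move=> mf bf sw; have mfz := emeas_slice z mf sw; apply/integrableP; split => //.
apply: (@le_lt_trans _ _ (K%:E * muX setT)%E).
  apply: integral_le_bound => //.
    (* An arbitrary extension of the history, here with [x = 0], witnesses [0 <= K]. *)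
    by rewrite (le_trans _ (bf (0 :: hx) (z :: hy) _))//; exact: hist_size_cons.
  by apply/aeW => x _; apply: bf; exact: hist_size_cons.
by rewrite probability_setT mule1 ltry.
Qed.

Lemma ebound_integral t K f hx hy z : emeas_at t.+1 f -> ebound_at t.+1 K f ->
  hist_size t hx hy -> (`|\int[muX]_x f (x :: hx) (z :: hy)| <= K%:E)%E.
Proof.
move=> mf bf sw; rewrite -[K%:E]mule1 -(probability_setT muX).
apply: (le_trans (le_abse_integral _ _ _)) => //; first exact: emeas_slice.
apply: integral_le_bound => //; first exact: emeas_slice.
  exact: (le_trans _ (bf _ _ (hist_size_cons 0 z sw))).
by apply/aeW => x _; apply: bf; exact: hist_size_cons.
Qed.

Lemma step_weight m t hx y hy : admissible P m ->
  (forall z, 0 <= P y z * m t.+1 hx (y :: hy) z) /\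
  \sum_(z : Y) P y z * m t.+1 hx (y :: hy) z = 1.
Proof.
move=> [mM _]; have [m0 m1] := mM t hx y hy; split.
  by move=> z; rewrite mulr_ge0.
by rewrite -[RHS]m1; apply: eq_bigr => z _; rewrite mulrC.
Qed.

Section one_step.
Context (m : distortion) (t : nat) (hx : seq R) (hy : seq Y).
Hypotheses (am : admissible P m) (sw : hist_size t hx hy).

Lemma eq_step f g : (forall hx hy, hist_size t.+1 hx hy -> f hx hy = g hx hy) ->
  step m t f hx hy = step m t g hx hy.
Proof.
move=> fg; rewrite /step; move: (sw); case: hy => [|y hy'] // sw'.
apply: eq_bigr => z _; congr (_ * _)%E; apply: eq_integral => x _.
by apply: fg; exact: hist_size_cons.
Qed.

Lemma le_step f g : emeas_at t.+1 f -> emeas_at t.+1 g ->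
  (forall hx hy, hist_size t.+1 hx hy -> (f hx hy <= g hx hy)%E) ->
  (step m t f hx hy <= step m t g hx hy)%E.
Proof.
move=> mf mg fg; rewrite /step; move: (sw); case: hy => [|y hy'] // sw'.
apply: lee_sum => z _; apply: lee_wpmul2l.
  by rewrite lee_fin; have [] := step_weight t hx y hy' am.
apply: le_integral_measurable => [||x]; try exact: emeas_slice.
by apply: fg; exact: hist_size_cons.
Qed.

Lemma step_ge0Z f (k : R) : emeas_at t.+1 f -> 0 <= k ->
  step m t (fun hx hy => k%:E * f hx hy)%E hx hy = (k%:E * step m t f hx hy)%E.
Proof.
move=> mf k0; rewrite /step; move: (sw); case: hy => [|y hy'] // sw'.
 by rewrite mule0.
rewrite ge0_mule_sumr//; apply: eq_bigr => z _.
have mfz := emeas_slice z mf sw'.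
by rewrite integral_ge0Zl// muleCA.
Qed.

(** Only [g] is bounded: [f] will be the discounted tail, whose conditional expectation may be
    infinite. *)
Lemma stepD K f g : emeas_at t.+1 f -> emeas_at t.+1 g -> ebound_at t.+1 K g ->
  step m t (fun hx hy => f hx hy + g hx hy)%E hx hy =
  (step m t f hx hy + step m t g hx hy)%E.
Proof.
move=> mf mg bg; rewrite /step; move: (sw); case: hy => [|y hy'] // sw'.
  by rewrite adde0.
rewrite -big_split/=; apply: eq_bigr => z _.
have ig := ebounded_integrable z mg bg sw'.
rewrite integralD_integrable_r//; last exact: emeas_slice.
by rewrite muleDr// fin_num_adde_defl// integrable_fin_num.
Qed.

Lemma ebound_step K f : emeas_at t.+1 f -> ebound_at t.+1 K f ->
  (`|step m t f hx hy| <= K%:E)%E.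
Proof.
move=> mf bf; rewrite /step; move: (sw); case: hy => [|y hy'] // sw'.
  by case: sw'.
have [w0 w1] := step_weight t hx y hy' am.
apply: (le_trans (lee_abs_sum _ _ _)).
rewrite (_ : K%:E = (\sum_z (P y z * m t.+1 hx (y :: hy') z)%:E * K%:E)%E); last first.
  by rewrite -ge0_sume_distrl ?sumEFin ?w1 ?mul1e// => z _; rewrite lee_fin.
apply: lee_sum => z _; rewrite abseM gee0_abs ?lee_fin//.
apply: lee_wpmul2l; rewrite ?lee_fin//; exact: ebound_integral.
Qed.
End one_step.

Lemma ebound_Ew m t j K f : admissible P m -> emeas_at (t + j) f ->
  ebound_at (t + j) K f -> ebound_at t K (Ew P muX m t j f).
Proof.
move=> am; elim: j t => [|j IH] t; first by rewrite addn0.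
rewrite -addSnnS => mf bf hx hy sw; rewrite EwS; apply: ebound_step => //.
  exact: emeas_Ew.
exact: IH.
Qed.

(** * Bounds on the conditional entropy, uniform over likelihood ratios *)

Definition entropy_bound : R := \sum_(y : Y) \sum_(z : Y) (P y z)^-1.

(** The tangent at [v = 1] is [lam z - 1], which has mean zero under [P]. *)
Lemma cond_entropy_ge0 y lam : in_M P y lam -> 0 <= cond_entropy P lam y.
Proof.
move=> [l0 l1]; apply: (@le_trans _ _ (\sum_z (lam z * P y z - P y z))).
  by case: Pstoch => _ P1; rewrite sumrB l1 P1 subrr.
apply: ler_sum => z _; have := mul_ln_ge_tangent (l0 z) (@ltr01 R).
by rewrite ln1 mulr0 add0r => /(ler_wpM2l (P_ge0 y z)); rewrite mulrBr mulr1 mulrC.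
Qed.

(** The constraint gives [lam z * P y z <= 1], and [ln] is sublinear, so each term is at most [lam z
    * P y z * lam z <= lam z <= (P y z)^-1]. States with [P y z = 0] contribute [0], as
    [0^-1 = 0]. *)
Lemma cond_entropy_le y lam : in_M P y lam ->
  cond_entropy P lam y <= entropy_bound.
Proof.
move=> [l0 l1]; apply: (@le_trans _ _ (\sum_z (P y z)^-1)); last first.
  rewrite /entropy_bound [leRHS](bigD1 y)//= lerDl; apply: sumr_ge0 => i _.
  by apply: sumr_ge0 => z _; rewrite invr_ge0.
apply: ler_sum => z _.
have [->|P0] := eqVneq (P y z) 0; first by rewrite mul0r invr0.
have Pgt0 : 0 < P y z by rewrite lt0r P0 P_ge0.
have lP : lam z * P y z <= 1.
  rewrite -l1 [leRHS](bigD1 z)//= lerDl; apply: sumr_ge0 => i _; exact: mulr_ge0.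
have lamP : lam z <= (P y z)^-1 by rewrite -[leRHS]mul1r ler_pdivlMr.
have := l0 z; rewrite le_eqVlt => /predU1P[<-|lz].
  by rewrite mul0r mulr0 invr_ge0.
apply: (le_trans _ lamP); rewrite mulrA [P y z * _]mulrC.
apply: (@le_trans _ _ (lam z * P y z * lam z)); last first.
  by rewrite -[leRHS]mul1r ler_wpM2r// ltW.
by rewrite ler_wpM2l ?mulr_ge0// ltW// ln_sublinear.
Qed.

(** * Discounted costs along a distortion and their unrolling *)

Context (gamma theta : R) (c : nat -> seq R -> seq Y -> R) (C : R).
Hypotheses (gamma01 : 0 < gamma < 1) (theta_gt0 : 0 < theta).
Hypotheses (mc : hist_measurable c) (cC : forall t hx hy, `|c t hx hy| <= C).

Definition flow m (s : nat) (hx : seq R) (hy : seq Y) : R :=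
  c s hx hy + theta * gamma * entropy_at P m s hx hy.

Definition flow_bound : R := C + theta * gamma * entropy_bound.

Lemma ebound_flow m t : admissible P m ->
  ebound_at t flow_bound (fun hx hy => (flow m t hx hy)%:E).
Proof.
move=> [mM _] hx [|y hy] [_ //= _]; rewrite lee_fin /flow /flow_bound/=.
have [g0 _] := andP gamma01.
have e0 := cond_entropy_ge0 (mM t hx y hy).
rewrite (le_trans (ler_normD _ _))// lerD// ger0_norm.
  by rewrite ler_wpM2l ?cond_entropy_le// mulr_ge0// ltW.
by rewrite !mulr_ge0// ltW.
Qed.

Lemma emeas_flow m t : admissible P m ->
  emeas_at t (fun hx hy => (flow m t hx hy)%:E).
Proof.
move=> [_ mm] ys; apply/measurable_EFinP; apply: measurable_funD; first exact: mc.
apply: measurable_funM; first exact: measurable_cst.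
rewrite /entropy_at; have mmt z := mm z t ys.
move: mmt; case: (tval ys) => [|y hy] mmt; first exact: measurable_cst.
apply: measurable_sum => z; apply: measurable_funM; first exact: measurable_cst.
apply: measurable_funM; first exact: mmt.
by apply: measurableT_comp (mmt z); exact: measurable_ln.
Qed.

Let gamma_ge0 : 0 <= gamma. Proof. by case/andP: gamma01 => /ltW. Qed.

Local Notation process := (nat -> seq R -> seq Y -> R).
Implicit Types (U : process).

Definition running_cost m t n hx hy : \bar R := (\sum_(0 <= j < n) (gamma ^+ j)%:E *
  Ew P muX m t j (fun hx hy => (flow m (t + j) hx hy)%:E) hx hy)%E.

Definition tail_cost U m t n hx hy : \bar R := ((gamma ^+ n)%:E *
  Ew P muX m t n (fun hx hy => (U (t + n)%N hx hy)%:E) hx hy)%E.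

Lemma emeas_Ew_flow m t j : admissible P m ->
  emeas_at t (Ew P muX m t j (fun hx hy => (flow m (t + j) hx hy)%:E)).
Proof. by move=> am; apply: emeas_Ew => //; exact: emeas_flow. Qed.

Lemma ebound_Ew_flow m t j : admissible P m ->
  ebound_at t flow_bound (Ew P muX m t j (fun hx hy => (flow m (t + j) hx hy)%:E)).
Proof.
by move=> am; apply: ebound_Ew => //; [exact: emeas_flow|exact: ebound_flow].
Qed.

Lemma emeasM t (k : R) f : emeas_at t f -> emeas_at t (fun hx hy => k%:E * f hx hy)%E.
Proof. by move=> mf ys; apply: measurable_funeM; exact: mf. Qed.

Lemma emeas_running_cost m t n : admissible P m ->
  emeas_at t (running_cost m t n).
Proof.
move=> am ys; apply: emeasurable_sum => j.
by apply: emeasM; exact: emeas_Ew_flow.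
Qed.

Lemma emeas_tail_cost U m t n : hist_measurable U -> admissible P m ->
  emeas_at t (tail_cost U m t n).
Proof.
move=> mU am; apply: emeasM; apply: emeas_Ew => //.
exact: hist_measurable_emeas.
Qed.

Lemma ebound_discounted_flow m t j : admissible P m ->
  ebound_at t flow_bound (fun hx hy => (gamma ^+ j)%:E *
    Ew P muX m t j (fun hx hy => (flow m (t + j) hx hy)%:E) hx hy)%E.
Proof.
move=> am hx hy sw; have := ebound_Ew_flow j am sw.
rewrite abseM [`|_%:E|%E]gee0_abs ?lee_fin ?exprn_ge0//; apply: le_trans.
rewrite -[leRHS]mul1e; apply: lee_wpmul2r => //; rewrite lee_fin exprn_ile1//.
by case/andP: gamma01 => _ /ltW.
Qed.

(** The growth in [n] is harmless: this bound only provides the bounded summand for [stepD] at a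
    fixed horizon. *)
Lemma ebound_running_cost m t n : admissible P m ->
  ebound_at t (n%:R * flow_bound) (running_cost m t n).
Proof.
move=> am hx hy sw; apply: (le_trans (lee_abs_sum _ _ _)).
apply: (@le_trans _ _ (\sum_(0 <= j < n) flow_bound%:E)%E).
  by apply: lee_sum => j _; exact: ebound_discounted_flow.
by rewrite sumEFin sumr_const_nat subn0 mulr_natl.
Qed.

Lemma step_running_cost m t n hx hy : admissible P m -> hist_size t hx hy ->
  step m t (running_cost m t.+1 n) hx hy = (\sum_(0 <= j < n) (gamma ^+ j)%:E *
  Ew P muX m t j.+1 (fun hx hy => (flow m (t + j.+1) hx hy)%:E) hx hy)%E.
Proof.
move=> am sw; elim: n => [|n IH].
  rewrite big_nil /step; case: hy sw => // y hy _.
  rewrite big1// => z _.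
  by rewrite integral0_eq ?mule0// => x _; rewrite /running_cost big_nil.
rewrite big_nat_recr// -IH.
rewrite (eq_step m sw (g := fun hx hy => running_cost m t.+1 n hx hy +
   (gamma ^+ n)%:E * Ew P muX m t.+1 n
     (fun hx hy => (flow m (t.+1 + n) hx hy)%:E) hx hy)%E); last first.
  by move=> hx' hy' _; rewrite /running_cost big_nat_recr.
rewrite (stepD m sw (@emeas_running_cost m t.+1 n am)
  (emeasM (gamma ^+ n) (@emeas_Ew_flow m t.+1 n am))
  (@ebound_discounted_flow m t.+1 n am)).
rewrite step_ge0Z; first by rewrite EwS -addSnnS.
- exact: sw.
- exact: emeas_Ew_flow.
- exact: exprn_ge0.

Qed.

(** Splits off the first period; one factor [gamma] comes out of the remaining sum, which is the
    same expression one date later. *)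
Lemma unroll m U t n hx hy : admissible P m -> hist_measurable U ->
  hist_size t hx hy ->
  (running_cost m t n.+1 hx hy + tail_cost U m t n.+1 hx hy =
   (flow m t hx hy)%:E + gamma%:E *
     step m t (fun hx hy => running_cost m t.+1 n hx hy + tail_cost U m t.+1 n hx hy)
       hx hy)%E.
Proof.
move=> am mU sw.
have mT := @emeas_tail_cost U m t.+1 n mU am.
have mR := @emeas_running_cost m t.+1 n am.
have bR := @ebound_running_cost m t.+1 n am.
(* The summands are swapped because [stepD] wants the bounded one on the right. *)
rewrite (eq_step m sw (g := fun hx hy => tail_cost U m t.+1 n hx hy +
  running_cost m t.+1 n hx hy)%E); last by move=> *; rewrite addeC.
rewrite (stepD m sw mT mR bR) [(step m t (tail_cost _ _ _ _) _ _ + _)%E]addeC.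
rewrite muleDr_ge0l// addeA; congr (_ + _)%E.
- rewrite step_running_cost// /running_cost big_nat_recl// expr0 mul1e addn0.
  congr (_ + _)%E; rewrite ge0_mule_sumr//.
  by apply: eq_bigr => j _; rewrite exprS EFinM muleA.
- rewrite /tail_cost step_ge0Z ?exprn_ge0//; last first.
    by apply: emeas_Ew => //; exact: hist_measurable_emeas.
  by rewrite muleA -EFinM -exprS EwS -addSnnS.
Qed.

(** * From the functional equation to the sequential problem *)

Lemma FP_MA_certainty_equivalent U t hx y hy : FP_MA P muX gamma theta c U ->
  hist_size t hx (y :: hy) ->
  [/\ forall z, 0 < P y z -> calU muX U t hx (y :: hy) z != -oo%E,
     0 < partition_function P theta y (calU muX U t hx (y :: hy)) &
     U t hx (y :: hy) = c t hx (y :: hy) +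
       gamma * certainty_equivalent P theta y (calU muX U t hx (y :: hy))].
Proof.
move=> FP [shx [shy]]; have [v [vmin Uv]] := FP t hx y hy shx shy.
have [g0 _] := andP gamma01.
(* [U] is real-valued and [gamma > 0], so an infinite minimum would contradict the equation. *)
have vfin : v \is a fin_num.
  case: v Uv {vmin} => [r| |]//.
    by rewrite gt0_muley ?lte_fin.
  by rewrite gt0_muleNy ?lte_fin.
have [aNoo Z0 vE] := finite_min_certainty_equivalent Pstoch theta_gt0 vfin vmin.
by split => //; move: Uv; rewrite vE => -[].
Qed.

Lemma flow_step m f t hx y hy :
  ((c t hx (y :: hy))%:E + gamma%:E * (step m t f hx (y :: hy) +
    (theta * cond_entropy P (m t.+1 hx (y :: hy)) y)%:E) =
   (flow m t hx (y :: hy))%:E + gamma%:E * step m t f hx (y :: hy))%E.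
Proof.
rewrite muleDr_ge0l// [(gamma%:E * step _ _ _ _ _ + _)%E]addeC addeA.
by congr (_ + _)%E; rewrite -EFinM -EFinD mulrCA mulrA.
Qed.

Lemma FP_MA_le_step U m t hx hy : FP_MA P muX gamma theta c U ->
  admissible P m -> hist_size t hx hy ->
  ((U t hx hy)%:E <= (flow m t hx hy)%:E +
    gamma%:E * step m t (fun hx hy => (U t.+1 hx hy)%:E) hx hy)%E.
Proof.
case: hy => [|y hy] FP [mM _] sw; first by case: sw.
have [aNoo Z0 ->] := FP_MA_certainty_equivalent FP sw.
rewrite -flow_step EFinD EFinM leeD2l// lee_wpmul2l ?lee_fin//.
exact: (certainty_equivalent_le Pstoch theta_gt0 (mM t hx y hy) aNoo Z0).
Qed.

(** Candidate minimiser of the sequential problem: at [w^t] the law of the next state is tilted by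
    the continuation value. The index [t.+1] goes with the history [w^t], as in the convention for
    distortions. *)
Definition gibbs_distortion U : distortion := fun s hx hy z =>
  match s, hy with
  | t.+1, y :: _ => gibbs P theta y (calU muX U t hx hy) z
  | _, _ => 1
  end.

(** The constraint [in_M] is tested on sequences of every size, where the default branch of [gibbs]
    keeps it true; measurability is tested only on tuples of matching size, where the functional
    equation makes the partition function positive. *)
Lemma admissible_gibbs_distortion U : hist_measurable U ->
  FP_MA P muX gamma theta c U -> admissible P (gibbs_distortion U).
Proof.
move=> mU FP; split=> [t hx y hy|z t ys]; first exact: gibbs_in_M.
rewrite /gibbs_distortion.
have mc' w := emeas_integral w (@hist_measurable_emeas U t.+1 mU) ys.
have szx (xs : t.+1.-tuple R) : size xs = t.+1 by rewrite size_tuple.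
have : size ys = t.+1 by rewrite size_tuple.
move: mc'; case: (tval ys) => // y hy mc' szy.
apply: measurable_gibbs => // xs.
by have [] := FP_MA_certainty_equivalent FP (conj (szx xs) szy).
Qed.

Lemma FP_MA_eq_step U t hx hy : FP_MA P muX gamma theta c U -> hist_size t hx hy ->
  ((U t hx hy)%:E = (flow (gibbs_distortion U) t hx hy)%:E + gamma%:E *
     step (gibbs_distortion U) t (fun hx hy => (U t.+1 hx hy)%:E) hx hy)%E.
Proof.
case: hy => [|y hy] FP sw; first by case: sw.
have [aNoo Z0 ->] := FP_MA_certainty_equivalent FP sw.
rewrite -flow_step EFinD EFinM; congr (_ + _ * _)%E.
exact/esym/(distorted_cost_gibbs Pstoch theta_gt0 aNoo Z0).
Qed.

(** Iterates [FP_MA_le_step]; the induction ranges over all dates because its hypothesis is applied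
    at [t.+1] inside [step]. *)
Lemma FP_MA_le_unroll U m t n hx hy : hist_measurable U ->
  FP_MA P muX gamma theta c U -> admissible P m -> hist_size t hx hy ->
  ((U t hx hy)%:E <= running_cost m t n hx hy + tail_cost U m t n hx hy)%E.
Proof.
move=> mU FP am; elim: n t hx hy => [|n IH] t hx hy sw.
  by rewrite /running_cost big_nil add0e /tail_cost expr0 mul1e addn0.
apply: (le_trans (FP_MA_le_step FP am sw)); rewrite unroll//.
rewrite leeD2l// lee_wpmul2l ?lee_fin//; apply: le_step => //.
- exact: hist_measurable_emeas.
- by move=> ys; apply: emeasurable_funD; [exact: emeas_running_cost|exact: emeas_tail_cost].
- by move=> hx' hy'; exact: IH.
Qed.

Lemma FP_MA_eq_unroll U t n hx hy : hist_measurable U ->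
  FP_MA P muX gamma theta c U -> hist_size t hx hy ->
  ((U t hx hy)%:E = running_cost (gibbs_distortion U) t n hx hy +
    tail_cost U (gibbs_distortion U) t n hx hy)%E.
Proof.
move=> mU FP; have am := admissible_gibbs_distortion mU FP.
elim: n t hx hy => [|n IH] t hx hy sw.
  by rewrite /running_cost big_nil add0e /tail_cost expr0 mul1e addn0.
rewrite FP_MA_eq_step// unroll//; congr (_ + _ * _)%E.
by apply: eq_step => // hx' hy'; exact: IH.
Qed.

(** The terms are dominated by the geometric series [flow_bound * gamma ^+ j]. Finiteness of the
    limit lets the limit of the tail be added to it. *)
Lemma running_cost_cvg m t hx hy : admissible P m -> hist_size t hx hy ->
  running_cost m t n hx hy @[n --> \oo] --> sp_objective P muX gamma theta c m t hx hy
  /\ sp_objective P muX gamma theta c m t hx hy \is a fin_num.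
Proof.
move=> am sw.
pose e j := Ew P muX m t j (fun hx hy => (flow m (t + j) hx hy)%:E) hx hy.
have eb j : (`|e j| <= flow_bound%:E)%E by exact: ebound_Ew_flow.
have ef j : e j \is a fin_num.
  by rewrite -abse_fin_num fin_numElt (lt_le_trans _ (abse_ge0 _))// (le_lt_trans (eb j)) ?ltry.
have rE : (fun n => running_cost m t n hx hy) =
    EFin \o series (fun j => gamma ^+ j * fine (e j)).
  apply/funext => n; rewrite /running_cost /series/= -sumEFin.
  by apply: eq_bigr => j _; rewrite EFinM fineK.
have sc : cvgn (series (fun j => gamma ^+ j * fine (e j))).
  apply: normed_cvg; apply: (@series_le_cvg _ _ (geometric flow_bound gamma)).
  - by move=> n; exact: normr_ge0.
  - move=> n; rewrite mulr_ge0 ?exprn_ge0// -lee_fin.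
    exact: (le_trans (abse_ge0 (e 0%N))).
  - move=> n /=; rewrite normrM ger0_norm ?exprn_ge0// mulrC ler_wpM2r ?exprn_ge0//.
    by rewrite -lee_fin; move: (eb n); rewrite -{1}(fineK (ef n)).
  - by apply: is_cvg_geometric_series; rewrite ger0_norm//; case/andP: gamma01.
have -> : sp_objective P muX gamma theta c m t hx hy =
    (limn (series (fun j => gamma ^+ j * fine (e j))))%:E.
  by rewrite -EFin_lim// -rE.
by split => //; rewrite rE; apply: cvg_EFin; [exact: nearW|exact: sc].
Qed.

Lemma FP_MA_SP_MA U : hist_measurable U -> FP_MA P muX gamma theta c U ->
  transversality P muX gamma U -> SP_MA P muX gamma theta c U.
Proof.
move=> mU FP tr t hx hy shx shy; have sw : hist_size t hx hy by [].
have unroll_cvg m : admissible P m -> (running_cost m t n hx hy +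
    tail_cost U m t n hx hy)%E @[n --> \oo] -->
    sp_objective P muX gamma theta c m t hx hy.
  move=> am; have [rc spf] := running_cost_cvg am sw.
  rewrite -[X in _ --> X]adde0; apply: cvgeD => //.
    exact: fin_num_adde_defr.
  (* [transversality] speaks of horizons [n.+1], hence the shift. *)
  by rewrite -cvg_shiftS; exact: tr.
split.
- exists (gibbs_distortion U); first exact: admissible_gibbs_distortion.
  have := unroll_cvg _ (admissible_gibbs_distortion mU FP).
  (* Along the Gibbs distortion the unrolled cost equals [U] at every horizon, so its limit is
     [U]. *)
  rewrite (_ : (fun n => _) = cst (U t hx hy)%:E).
    by move=> /cvg_lim <- //; rewrite lim_cst.
  by apply/funext => n; rewrite -FP_MA_eq_unroll.
- move=> _ [m am <-]; apply: cvge_ge (unroll_cvg _ am).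
  by apply: nearW => n; exact: FP_MA_le_unroll.
Qed.

(** * A bounded solution of the functional equation by value iteration *)

Let gamma_lt1 : gamma < 1. Proof. by case/andP: gamma01. Qed.
Let C_ge0 : 0 <= C. Proof. exact: le_trans (cC 0%N [::] [::]). Qed.

(** The fixed point of [K |-> C + gamma * K], so that one iteration preserves the bound. *)
Definition value_bound : R := C / (1 - gamma).

Let value_boundE : C + gamma * value_bound = value_bound.
Proof. by rewrite /value_bound; field; rewrite subr_eq0 gt_eqF. Qed.

Fixpoint value_iter (n : nat) : process :=
  match n with
  | 0 => fun _ _ _ => - value_bound
  | n'.+1 => fun t hx hy =>
    match hy with
    | [::] => 0
    | y :: _ => c t hx hy +
        gamma * certainty_equivalent P theta y (calU muX (value_iter n') t hx hy)
    end
  end.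

Lemma value_iter_measurable n : hist_measurable (value_iter n).
Proof.
elim: n => [|n IH] t ys; first exact: measurable_cst.
have mI z := emeas_integral z (@hist_measurable_emeas _ t.+1 IH) ys.
have mct := @mc t ys; move: mI mct => /=.
case: (tval ys) => [|y hy] mI mct; first exact: measurable_cst.
apply: measurable_funD => //; apply: measurable_funM; first exact: measurable_cst.
apply: measurable_funM; first exact: measurable_cst.
apply: measurableT_comp; first exact: measurable_ln.
exact: measurable_partition_function.
Qed.

Lemma ebound_calU U t hx hy z : hist_measurable U ->
  ebound_at t.+1 value_bound (fun hx hy => (U t.+1 hx hy)%:E) ->
  hist_size t hx hy -> (`|calU muX U t hx hy z| <= value_bound%:E)%E.
Proof.
move=> mU bU sw; apply: (ebound_integral z _ bU sw).
exact: hist_measurable_emeas.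
Qed.

Lemma ebound_value_iter n t :
  ebound_at t value_bound (fun hx hy => (value_iter n t hx hy)%:E).
Proof.
elim: n t => [|n IH] t hx [|y hy] sw //=; rewrite ?lee_fin.
- by rewrite normrN ger0_norm// divr_ge0// subr_ge0 ltW.
- by rewrite normrN ger0_norm// divr_ge0// subr_ge0 ltW.
- by rewrite normr0 divr_ge0// subr_ge0 ltW.
rewrite (le_trans (ler_normD _ _))// -[leRHS]value_boundE lerD//.
rewrite normrM ger0_norm// ler_wpM2l// certainty_equivalent_bound// => z.
by apply: ebound_calU => //; exact: value_iter_measurable.
Qed.

Lemma calU_fin_num U t hx hy z : hist_measurable U ->
  ebound_at t.+1 value_bound (fun hx hy => (U t.+1 hx hy)%:E) ->
  hist_size t hx hy -> calU muX U t hx hy z \is a fin_num.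
Proof.
move=> mU bU sw; have h := ebound_calU z mU bU sw.
by rewrite -abse_fin_num fin_numElt (lt_le_trans _ (abse_ge0 _))// (le_lt_trans h) ?ltry.
Qed.

Lemma value_iter_le n t hx hy : hist_size t hx hy ->
  value_iter n t hx hy <= value_iter n.+1 t hx hy.
Proof.
elim: n t hx hy => [|n IH] t hx hy sw.
  (* The iteration starts at the lower bound common to all iterates, which gives the base case. *)
  have := ebound_value_iter 1 sw; rewrite lee_fin ler_norml => /andP[+ _].
  exact.
case: hy sw => [|y hy] sw; first by case: sw.
rewrite lerD2l; apply: ler_wpM2l; first exact: gamma_ge0.
apply: (le_certainty_equivalent Pstoch theta_gt0) => z.
- by apply: calU_fin_num => //; [exact: value_iter_measurable|exact: ebound_value_iter].
- by apply: (@calU_fin_num (value_iter n.+1)) => //;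
    [exact: value_iter_measurable|exact: ebound_value_iter].
apply: le_integral_measurable.
- exact: (emeas_slice z (@hist_measurable_emeas _ t.+1 (value_iter_measurable n)) sw).
- exact: (emeas_slice z (@hist_measurable_emeas _ t.+1 (value_iter_measurable n.+1)) sw).
- by move=> x; rewrite lee_fin; apply: IH; exact: hist_size_cons.
Qed.

Definition value : process := fun t hx hy => limn (fun n => value_iter n t hx hy).

Lemma value_iter_cvg t hx hy : hist_size t hx hy ->
  value_iter n t hx hy @[n --> \oo] --> value t hx hy.
Proof.
move=> sw; apply: nondecreasing_is_cvgn.
  by apply/nondecreasing_seqP => n; exact: value_iter_le.
exists value_bound => _ [n _ <-].
by have := ebound_value_iter n sw; rewrite lee_fin ler_norml => /andP[].
Qed.

Lemma value_measurable : hist_measurable value.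
Proof.
move=> t ys; apply: (measurable_fun_cvg (fun n => @value_iter_measurable n t ys)).
by move=> xs _; apply: value_iter_cvg; split; rewrite size_tuple.
Qed.

Lemma ebound_value t : ebound_at t value_bound (fun hx hy => (value t hx hy)%:E).
Proof.
move=> hx hy sw; rewrite lee_fin ler_norml.
have h := value_iter_cvg sw.
have b n : - value_bound <= value_iter n t hx hy <= value_bound.
  by rewrite -ler_norml -lee_fin; exact: ebound_value_iter.
apply/andP; split.
  by apply: (cvgr_to_ge h); apply: nearW => n; have /andP[] := b n.
by apply: (cvgr_to_le h); apply: nearW => n; have /andP[] := b n.
Qed.

Lemma calU_value_cvg t hx hy z : hist_size t hx hy ->
  calU muX (value_iter n) t hx hy z @[n --> \oo] --> calU muX value t hx hy z.
Proof.
(* Dominated convergence: the constant [value_bound] is integrable under the probability [muX]. *)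
move=> sw; apply: (@dominated_cvg _ _ _ muX setT measurableT _ _ (cst value_bound%:E)).
- move=> n; exact: (emeas_slice z (@hist_measurable_emeas _ t.+1 (value_iter_measurable n)) sw).
- move=> x _; apply: cvg_EFin; first exact: nearW.
  by apply: value_iter_cvg; exact: hist_size_cons.
- by [].
- by apply: finite_measure_integrable_cst.
- by move=> n x _; apply: ebound_value_iter; exact: hist_size_cons.
Qed.

Lemma valueE t hx y hy : hist_size t hx (y :: hy) -> value t hx (y :: hy) =
  c t hx (y :: hy) +
    gamma * certainty_equivalent P theta y (calU muX value t hx (y :: hy)).
Proof.
(* The shift to [n.+1] exposes the recursion; both sides then pass to the limit. *)
move=> sw; have h := value_iter_cvg sw; rewrite -cvg_shiftS in h.
rewrite -[LHS](cvg_lim _ h)//; apply: cvg_lim => //=.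
apply: cvgD; first exact: cvg_cst.
apply: cvgMr; apply: cvg_certainty_equivalent => // [n z|z|z].
- by apply: calU_fin_num => //; [exact: value_iter_measurable|exact: ebound_value_iter].
- by apply: calU_fin_num => //; [exact: value_measurable|exact: ebound_value].
- exact: calU_value_cvg.
Qed.

Lemma value_FP_MA : FP_MA P muX gamma theta c value.
Proof.
move=> t hx y hy shx shy.
have sw : hist_size t hx (y :: hy) by split; rewrite /= ?shy.
have afin z : calU muX value t hx (y :: hy) z \is a fin_num.
  by apply: calU_fin_num => //; [exact: value_measurable|exact: ebound_value].
exists (certainty_equivalent P theta y (calU muX value t hx (y :: hy)))%:E; split.
  apply: (is_min_certainty_equivalent Pstoch theta_gt0) => [z _|].
    by have := afin z; rewrite fin_numE => /andP[].
  exact: partition_function_fin_gt0.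
by rewrite valueE// EFinD EFinM.
Qed.

Lemma value_transversality : transversality P muX gamma value.
Proof.
move=> m am t hx hy shx shy; have sw : hist_size t hx hy by [].
have b n : (`|Ew P muX m t n (fun hx hy => (value (t + n)%N hx hy)%:E) hx hy| <=
    value_bound%:E)%E.
  apply: ebound_Ew => //; last exact: ebound_value.
  exact: hist_measurable_emeas value_measurable.
(* The weights of a distorted expectation sum to one, so the tail is squeezed by the discounted
   bound. *)
have g0 : (gamma ^+ n.+1 * value_bound)%:E @[n --> \oo] --> 0%E.
  apply: cvg_EFin; first exact: nearW.
  rewrite -[X in _ --> X](mul0r value_bound); apply: cvgMl.
  have /cvg_expr : `|gamma| < 1 by rewrite ger0_norm.
  by rewrite -cvg_shiftS.
have bg n : (`|(gamma ^+ n)%:E *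
    Ew P muX m t n (fun hx hy => (value (t + n)%N hx hy)%:E) hx hy| <=
    (gamma ^+ n * value_bound)%:E)%E.
  rewrite abseM [`|_%:E|%E]gee0_abs ?lee_fin ?exprn_ge0// EFinM.
  by apply: lee_wpmul2l; rewrite ?lee_fin ?exprn_ge0//; exact: b.
apply/cvg_abse0P; apply: (squeeze_cvge _ (cvg_cst 0%E) g0).
by apply: nearW => n; apply/andP; split; [exact: abse_ge0|exact: bg].
Qed.

Lemma is_min_unique (S : set (\bar R)) v w : is_min S v -> is_min S w -> v = w.
Proof.
by move=> [Sv vS] [Sw wS]; apply/eqP; rewrite eq_le vS//= wS.
Qed.

Lemma SP_MA_FP_MA U : SP_MA P muX gamma theta c U -> FP_MA P muX gamma theta c U.
Proof.
move=> SPU.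
have SPV := FP_MA_SP_MA value_measurable value_FP_MA value_transversality.
(* Both processes are minima of the same set of objectives. The equality is limited to consistent
   history sizes, which are the only ones the functional equation evaluates. *)
have UV t hx hy : hist_size t hx hy -> U t hx hy = value t hx hy.
  move=> [shx shy].
  by have [] := is_min_unique (SPU t hx hy shx shy) (SPV t hx hy shx shy).
move=> t hx y hy shx shy.
have sw : hist_size t hx (y :: hy) by split; rewrite /= ?shy.
have [v [vmin vE]] := value_FP_MA y shx shy.
exists v; split; last by rewrite UV.
suff -> : fp_objective P muX theta U t hx y hy =
    fp_objective P muX theta value t hx y hy by [].
apply/funext => lam; congr (_ + _)%E; apply: eq_bigr => z _; congr (_ * _)%E.
by apply: eq_integral => x _; rewrite UV//; exact: hist_size_cons.
Qed.

End conditional_expectations.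

Theorem theoremS1 (R : realType) (Y : finType) (P : Y -> Y -> R)
  (xl xh : R) (muX : probability R R) (gamma theta : R)
  (c : nat -> seq R -> seq Y -> R) (C : R) :
  stochastic P ->
  has_density_on xl xh muX ->
  0 < gamma < 1 -> 0 < theta ->
  hist_measurable c ->
  (forall t hx hy, `|c t hx hy| <= C) ->
  (* (a) *)
  (forall U : nat -> seq R -> seq Y -> R,
     hist_measurable U ->
     SP_MA P muX gamma theta c U -> FP_MA P muX gamma theta c U)
  /\
  (* (b) *)
  (forall Ubar : nat -> seq R -> seq Y -> R,
     hist_measurable Ubar ->
     FP_MA P muX gamma theta c Ubar ->
     transversality P muX gamma Ubar ->
     SP_MA P muX gamma theta c Ubar).
Proof.
move=> Pst _ g01 th0 mc cC; split=> U mU.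
  exact: (SP_MA_FP_MA Pst g01 th0 mc cC).
exact: (FP_MA_SP_MA Pst g01 th0 mc cC mU).
Qed.
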